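(* Let $\Sigma$ be finite, $\Gamma=2^\Sigma\setminus\{\emptyset\}$. (a) For every $\mu\mathsf{RatMTL}$ sentence $\psi$ there is a 1-clock ATA $\mathcal{A}$ over $\Gamma$ with $L(\psi)=L(\mathcal{A})$. (b) For every $\mu\mathsf{FRatMTL}$ sentence $\psi$ there is a $\mathsf{C}\oplus\mathsf{D}$ 1-clock ATA $\mathcal{A}$ over $\Gamma$ with $L(\psi)=L(\mathcal{A})$.
   Context: Timed words $\rho=(\sigma,\tau)$: $\sigma_i\in\Gamma$, $\tau_i\in\mathbb{R}_{\ge0}$, $\tau_1=0$, $\tau_i\le\tau_{i+1}$. Intervals: intervals of $\mathbb{R}_{\ge0}$ with endpoints in $\mathbb{N}\cup\{\infty\}$. 1-clock ATA $\mathcal{A}=(\Gamma,Q,q_0,F,\delta)$, $\delta:Q\times\Gamma\to\Phi(Q)$, $\Phi(Q)$: $\varphi::=\top\mid\bot\mid\varphi\wedge\varphi\mid\varphi\vee\varphi\mid q\mid x\in I\mid x.q$ ($x.q$: go to $q$ resetting the clock $x$). A successor of configuration $C$ (finite set of $(q,\nu)$) on $a$ chooses for each $(s,\nu)\in C$ a set $M\subseteq Q\cup\{x.q\}$ satisfying $\delta(s,a)$ ($x\in I$ true iff $\nu\in I$) and unites $\{(p,\nu):p\in M\}\cup\{(q,0):x.q\in M\}$. Runs: $C_0=\{(q_0,0)\}$, $C_i$ a successor on $\sigma_i$ of $C_{i-1}$ with $\tau_i-\tau_{i-1}$ added to all valuations ($\tau_0=0$); accept iff some run ends with all locations in $F$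 (empty configuration accepting). $\mathsf{C}\oplus\mathsf{D}$: $Q=Q_\wedge\sqcup Q_\vee$; with $\mathcal{B}$ the positive Boolean combinations (incl. true, false) of atoms $x.q$: for $q\in Q_\wedge$, $\delta(q,a)=\bigwedge_i D_i$ with each $D_i\in\{q'\vee\beta\ (q'\in Q_\wedge),\ (x\in I)\vee\beta,\ \beta\}$, $\beta\in\mathcal{B}$; for $q\in Q_\vee$, $\delta(q,a)=\bigvee_iC_i$ with each $C_i\in\{q'\wedge\beta\ (q'\in Q_\vee),\ (x\in I)\wedge\beta,\ \beta\}$. $\mu\mathsf{RatMTL}$ over $\Sigma$ and a finite set $\mathcal{Z}$ of recursion variables: $\varphi::=a\mid\mathrm{true}\mid Z\mid\varphi\wedge\varphi\mid\neg\varphi\mid\mathsf{Rat}_I\mathsf{re}(\mathsf{S})\mid\mathsf{FRat}_{I,\mathsf{re}(\mathsf{S})}\varphi\mid\mathsf{GRat}_{I,\mathsf{re}(\mathsf{S})}\varphi\mid\mu Z\circ\varphi\mid\nu Z\circ\varphi$ ($\mathsf{S}$ a finite set of formulas, $\mathsf{re}(\mathsf{S})$ a regular expression over $\mathsf{S}$). Formulas are interpreted on super structures, timed words over $\Gamma\times 2^{\mathcal{Z}}$; $\rho,i\models Z$ iff $Z$ is in the label at $i$; $\rho,i\models\mathsf{FRat}_{I,\mathsf{re}}\varphi$ iff $\exists j>i$: $\rho,j\models\varphi$, $\tau_j-\tau_i\in I$, and there are $\psi_k\in\mathsf{S}$ with $\rho,k\models\psi_k$ for $i<k<j$ and $\psi_{i+1}\cdots\psi_{j-1}\in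 L(\mathsf{re})$; $\rho,i\models\mathsf{Rat}_I\mathsf{re}$ iff, listing in increasing order the positions $k$ with $\tau_k-\tau_i\in I$, one can choose $\psi_k\in\mathsf S$ with $\rho,k\models\psi_k$ so that the resulting word is in $L(\mathsf{re})$; $\mathsf{GRat}_{I,\mathsf{re}}\varphi\equiv\neg\mathsf{FRat}_{I,\mathsf{re}}\neg\varphi$. $\rho'$ is a fixpoint of $Z\equiv\varphi(Z)$ w.r.t. $\rho$ if $\rho,\rho'$ agree except on $Z$ and for all $i$, $\rho',i\models\varphi$ iff $\rho',i\models Z$; it is least (greatest) if its set of $Z$-positions is contained in (contains) that of every such fixpoint. $\rho,i\models\mu Z\circ\varphi$ ($\nu Z\circ\varphi$) iff $\rho'',i\models Z$ for the least (greatest) fixpoint $\rho''$. A sentence has all recursion variables bound; its language is $\{\rho\text{ timed word over }\Sigma:\rho,1\models\psi\}$. $\mu\mathsf{FRatMTL}$ is the fragment without $\mathsf{Rat}_I$. Only guarded formulas are considered: in every subformula $\mu Z\circ\psi$ or $\nu Z\circ\psi$, every occurrence of $Z$ in $\psi$ lies within the scope of a strict-future modality.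
   Formalization: In C⊕D, conjunctive locations may also use clauses (x∉I)∨β (without them (b) fails for ¬FRat_{[1,1],true*} true); Rat_I lists only positions k≥i (with earlier positions of equal time (a) fails); Rat_I counts as strict-future only when 0∉I. *)

(* Defs.v *)
From Stdlib Require List.
From HB Require Import structures.
From mathcomp Require Import all_boot all_order all_algebra finmap.
From mathcomp Require Import interval_inference reals.

Set Implicit Arguments.
Unset Strict Implicit.
Unset Printing Implicit Defensive.

Import Order.TTheory GRing.Theory Num.Theory.
Local Open Scope fset_scope.
Local Open Scope ring_scope.

(* Intervals are [interval nat]: a bound is a natural number or infinite. They
   are only tested on nonnegative reals, so a lower bound -oo means "from 0". *)
Definition in_nat_itv (R : realType) (t : R) (I : interval nat) : bool :=
  t \in map_itv (fun n : nat => n%:R : R) I.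

(* Nonempty finite timed words; positions are numbered from [ord0].
   Nonnegativity of the timestamps follows from the last two fields. *)
Record timed_word (R : realType) (G : Type) := TimedWord {
  tw_last : nat;
  tw_lab : 'I_tw_last.+1 -> G;
  tw_time : 'I_tw_last.+1 -> R;
  tw_time0 : tw_time ord0 = 0;
  tw_mono : forall i j : 'I_tw_last.+1, (i <= j)%N -> tw_time i <= tw_time j
}.

Notation position rho := 'I_(tw_last rho).+1.

Definition relabel (R : realType) (G H : Type) (rho : timed_word R G)
    (lab : position rho -> H) : timed_word R H :=
  TimedWord lab (tw_time0 rho) (@tw_mono _ _ rho).

Definition letter (Sigma : finType) : finType := {A : {set Sigma} | A != set0}.

Inductive regex (A : Type) :=
| REmpty
| REps
| RAtom of A
| RCat of regex A & regex A
| RAlt of regex A & regex A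
| RStar of regex A.

Fixpoint re_lang (A : eqType) (r : regex A) (w : seq A) : Prop :=
  match r with
  | REmpty => False
  | REps => w = [::]
  | RAtom a => w = [:: a]
  | RCat r1 r2 => exists u v, [/\ w = u ++ v, re_lang r1 u & re_lang r2 v]
  | RAlt r1 r2 => re_lang r1 w \/ re_lang r2 w
  | RStar r1 =>
      exists ws, w = flatten ws /\ forall u, u \in ws -> re_lang r1 u
  end.

(* In the rational modalities the finite set of formulas is given as a family
   Fs indexed by 'I_n, and the regular expression is over the indices. *)
Inductive formula (Sigma V : finType) :=
| FProp of Sigma
| FTrue
| FVar of V
| FAnd of formula Sigma V & formula Sigma V
| FNeg of formula Sigma V
| Rat (I : interval nat) (n : nat)
    (Fs : 'I_n -> formula Sigma V) (re : regex 'I_n)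
| FRat (I : interval nat) (n : nat)
    (Fs : 'I_n -> formula Sigma V) (re : regex 'I_n) (phi : formula Sigma V)
| GRat (I : interval nat) (n : nat)
    (Fs : 'I_n -> formula Sigma V) (re : regex 'I_n) (phi : formula Sigma V)
| FMu (z : V) (phi : formula Sigma V)
| FNu (z : V) (phi : formula Sigma V).

Arguments FTrue {Sigma V}.

Definition super_structure (R : realType) (Sigma V : finType) :=
  timed_word R (letter Sigma * {set V}).

(* The structures agreeing with rho except on z are exactly the [set_var rho z X],
   X being the set of z-positions. *)
Definition set_var (R : realType) (Sigma V : finType)
    (rho : super_structure R Sigma V) (z : V) (X : {set position rho}) :
    super_structure R Sigma V :=
  relabel (fun k : position rho =>
    ((tw_lab k).1, if k \in X then z |: (tw_lab k).2 else (tw_lab k).2 :\ z)).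

Arguments set_var {R Sigma V} rho z X.

(* The positions ps, in this order, can be given indices a with H a k so that the
   resulting word belongs to the language of re. *)
Definition reads (T : eqType) (n : nat) (re : regex 'I_n)
    (H : 'I_n -> T -> Prop) (ps : seq T) : Prop :=
  exists w : seq 'I_n, [/\ re_lang re w, size w = size ps &
    forall a k, (a, k) \in zip w ps -> H a k].

Section Modalities.
Variables (R : realType) (G : Type) (rho : timed_word R G).
Variables (I : interval nat) (n : nat) (re : regex 'I_n).
Variables (H : 'I_n -> position rho -> Prop).

(* [enum] lists positions increasingly. Only positions from i onwards are listed:
   a position before i may carry the same timestamp as i. *)
Definition rat_sem (i : position rho) : Prop :=
  reads re H [seq k : position rho <- enum (position rho) |
    (i <= k)%N && in_nat_itv (tw_time k - tw_time i) I].

Definition frat_sem (P : position rho -> Prop) (i : position rho) : Prop :=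
  exists j : position rho,
    [/\ (i < j)%N, P j, in_nat_itv (tw_time j - tw_time i) I &
      reads re H [seq k : position rho <- enum (position rho) | (i < k < j)%N]].

End Modalities.

Section Fixpoints.
Variables (T : finType) (f : {set T} -> T -> Prop).

Definition fixpoint (X : {set T}) : Prop := forall i, f X i <-> i \in X.

Definition least_fixpoint (X : {set T}) : Prop :=
  fixpoint X /\ forall Y, fixpoint Y -> X \subset Y.

Definition greatest_fixpoint (X : {set T}) : Prop :=
  fixpoint X /\ forall Y, fixpoint Y -> Y \subset X.

End Fixpoints.

Fixpoint sat (R : realType) (Sigma V : finType) (phi : formula Sigma V) :
    forall rho : super_structure R Sigma V, position rho -> Prop :=
  match phi with
  | FProp a => fun rho i => a \in val (tw_lab i).1
  | FTrue => fun rho i => True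
  | FVar z => fun rho i => z \in (tw_lab i).2
  | FAnd p q => fun rho i => sat p i /\ sat q i
  | FNeg p => fun rho i => ~ sat p i
  | Rat J n Fs re => fun rho i =>
      rat_sem J re (fun a (k : position rho) => sat (Fs a) k) i
  | FRat J n Fs re p => fun rho i =>
      frat_sem J re (fun a (k : position rho) => sat (Fs a) k)
        (fun k => sat p k) i
  | GRat J n Fs re p => fun rho i =>
      ~ frat_sem J re (fun a (k : position rho) => sat (Fs a) k)
          (fun k => ~ sat p k) i
  | FMu z p => fun rho i => exists X : {set position rho},
      least_fixpoint
        (fun Y k => @sat R Sigma V p (set_var rho z Y) k) X /\ i \in X
  | FNu z p => fun rho i => exists X : {set position rho},
      greatest_fixpoint
        (fun Y k => @sat R Sigma V p (set_var rho z Y) k) X /\ i \in X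
  end.

Section Syntax.
Variables (Sigma V : finType).

Fixpoint free_in (z : V) (phi : formula Sigma V) : Prop :=
  match phi with
  | FProp _ | FTrue => False
  | FVar y => y = z
  | FAnd p q => free_in z p \/ free_in z q
  | FNeg p => free_in z p
  | Rat _ _ Fs _ => exists a, free_in z (Fs a)
  | FRat _ _ Fs _ p | GRat _ _ Fs _ p =>
      (exists a, free_in z (Fs a)) \/ free_in z p
  | FMu y p | FNu y p => y <> z /\ free_in z p
  end.

Definition sentence (phi : formula Sigma V) : Prop := forall z, ~ free_in z phi.

(* Every free occurrence of z lies in the scope of a strict-future modality, i.e.
   FRat, GRat, or Rat_I with 0 not in I (Rat_I inspects the current position
   when 0 is in I). *)
Fixpoint guarded_var (z : V) (phi : formula Sigma V) : Prop :=
  match phi with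
  | FProp _ | FTrue => True
  | FVar y => y <> z
  | FAnd p q => guarded_var z p /\ guarded_var z q
  | FNeg p => guarded_var z p
  | Rat J _ Fs _ => 0%N \notin J \/ forall a, guarded_var z (Fs a)
  | FRat _ _ _ _ _ | GRat _ _ _ _ _ => True
  | FMu y p | FNu y p => y = z \/ guarded_var z p
  end.

Fixpoint guarded (phi : formula Sigma V) : Prop :=
  match phi with
  | FProp _ | FTrue | FVar _ => True
  | FAnd p q => guarded p /\ guarded q
  | FNeg p => guarded p
  | Rat _ _ Fs _ => forall a, guarded (Fs a)
  | FRat _ _ Fs _ p | GRat _ _ Fs _ p =>
      (forall a, guarded (Fs a)) /\ guarded p
  | FMu z p | FNu z p => guarded_var z p /\ guarded p
  end.

(* The fragment without Rat_I. *)
Fixpoint rat_free (phi : formula Sigma V) : Prop :=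
  match phi with
  | FProp _ | FTrue | FVar _ => True
  | FAnd p q => rat_free p /\ rat_free q
  | FNeg p => rat_free p
  | Rat _ _ _ _ => False
  | FRat _ _ Fs _ p | GRat _ _ Fs _ p =>
      (forall a, rat_free (Fs a)) /\ rat_free p
  | FMu _ p | FNu _ p => rat_free p
  end.

(* The initial variable labels are irrelevant for sentences. *)
Definition models (R : realType) (rho : timed_word R (letter Sigma))
    (psi : formula Sigma V) : Prop :=
  @sat R Sigma V psi
    (relabel (fun k : position rho => (tw_lab k, set0))) ord0.

End Syntax.

Inductive ata_form (Q : Type) :=
| ATop
| ABot
| AAnd of ata_form Q & ata_form Q
| AOr of ata_form Q & ata_form Q
| ALoc of Q
| AClock of interval nat
| AReset of Q.

Arguments ATop {Q}.
Arguments ABot {Q}.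
Arguments AClock {Q}.

Record ata (G : Type) := Ata {
  ata_loc : finType;
  ata_init : ata_loc;
  ata_final : {set ata_loc};
  ata_delta : ata_loc -> G -> ata_form ata_loc
}.

(* In M : {set Q + Q}, [inl q] stands for q and [inr q] for x.q. *)
Fixpoint ata_sat (R : realType) (Q : finType) (nu : R) (M : {set Q + Q})
    (phi : ata_form Q) : bool :=
  match phi with
  | ATop => true
  | ABot => false
  | AAnd p q => ata_sat nu M p && ata_sat nu M q
  | AOr p q => ata_sat nu M p || ata_sat nu M q
  | ALoc q => inl q \in M
  | AClock J => in_nat_itv nu J
  | AReset q => inr q \in M
  end.

Section Runs.
Variables (R : realType) (G : Type) (A : ata G).

Definition config := {fset (ata_loc A * R)}.

Definition elapse (C : config) (d : R) : config :=
  [fset (c.1, c.2 + d) | c in C].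

Definition successor (a : G) (C C' : config) : Prop :=
  exists M : ata_loc A * R -> {set ata_loc A + ata_loc A},
    (forall c, c \in C -> ata_sat c.2 (M c) (ata_delta c.1 a)) /\
    (forall p nu, (p, nu) \in C' <->
      exists c, c \in C /\
        ((inl p \in M c /\ nu = c.2) \/ (inr p \in M c /\ nu = 0))).

Definition prev_time (rho : timed_word R G) (k : position rho) : R :=
  if k == 0%N :> nat then 0 else tw_time (inord k.-1 : position rho).

Definition run (rho : timed_word R G) (C : nat -> config) : Prop :=
  C 0%N = [fset (ata_init A, 0)] /\
  forall k : position rho,
    successor (tw_lab k) (elapse (C k) (tw_time k - prev_time k)) (C k.+1).

Definition accepts (rho : timed_word R G) : Prop :=
  exists C, run rho C /\
    forall c, c \in C (tw_last rho).+1 -> c.1 \in ata_final A.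

End Runs.

Section ConjDisj.
Variable Q : finType.

Fixpoint reset_comb (phi : ata_form Q) : bool :=
  match phi with
  | ATop | ABot | AReset _ => true
  | AAnd p q | AOr p q => reset_comb p && reset_comb q
  | ALoc _ | AClock _ => false
  end.

(* The constraint "x not in I"; the complement of an interval is the union of the
   two intervals on either side of it. *)
Definition AClock_out (I : interval nat) : ata_form Q :=
  let: Interval l u := I in
  AOr (AClock (Interval -oo%O l)) (AClock (Interval u +oo%O)).

(* [DClockOut] is the dual of [CClock]. For disjunctive locations (x notin I) /\ beta
   splits into two [CClock] clauses, but [DClockOut] cannot be recovered from
   [DClock], complements of intervals not being intervals in general. Without it no
   automaton of the class recognises ~ FRat_{[1,1], true^*} true ("no event at
   time 1"). *)
Inductive disj_clause (Qand : {set Q}) : ata_form Q -> Prop :=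
| DLoc q beta of q \in Qand & reset_comb beta :
    disj_clause Qand (AOr (ALoc q) beta)
| DClock I beta of reset_comb beta : disj_clause Qand (AOr (AClock I) beta)
| DClockOut I beta of reset_comb beta :
    disj_clause Qand (AOr (AClock_out I) beta)
| DReset beta of reset_comb beta : disj_clause Qand beta.

Inductive conj_clause (Qor : {set Q}) : ata_form Q -> Prop :=
| CLoc q beta of q \in Qor & reset_comb beta :
    conj_clause Qor (AAnd (ALoc q) beta)
| CClock I beta of reset_comb beta : conj_clause Qor (AAnd (AClock I) beta)
| CReset beta of reset_comb beta : conj_clause Qor beta.

Definition big_and (Ds : seq (ata_form Q)) := foldr (@AAnd Q) ATop Ds.
Definition big_or (Cs : seq (ata_form Q)) := foldr (@AOr Q) ABot Cs.

End ConjDisj.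

Definition conj_disj_ata (G : Type) (A : ata G) : Prop :=
  exists Qand : {set ata_loc A}, forall (q : ata_loc A) (a : G),
    if q \in Qand then
      exists Ds, ata_delta q a = big_and Ds /\
        List.Forall (disj_clause Qand) Ds
    else
      exists Cs, ata_delta q a = big_or Cs /\
        List.Forall (conj_clause (~: Qand)) Cs.

(* Main.v *)
(** Guardedness and the finiteness of words make the value of every formula at a
    position a Boolean function of the letter read there and of the predicates
    "location [q], started now with clock 0, holds on the rest of the word". Such
    predicates are given by a finite system of equations whose right-hand sides
    may negate started locations. The system is built by structural
    recursion: a rational modality adds the states of an automaton for its
    regular expression, and [mu Z] or [nu Z] (which coincide, the fixpoint being
    unique) replaces [Z] in every equation by the Boolean function of the body.
    Doubling the locations to dualise negated ones turns the system into an
    alternating automaton; without [Rat] no clause combines a clock test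
    with a location that keeps the clock, which gives the conjunctive-disjunctive
    shape. *)

Require Import Defs.
From HB Require Import structures.
From mathcomp Require Import all_boot all_order all_algebra finmap reals.

Set Implicit Arguments.
Unset Strict Implicit.
Unset Printing Implicit Defensive.

Import Order.TTheory GRing.Theory Num.Theory.
Local Open Scope fset_scope.
Local Open Scope ring_scope.

(** * Regular expressions and nondeterministic automata *)

(** There are no silent moves: each step reads one letter, so a run advances in lockstep with the
    positions of a word. Concatenation and star therefore merge a change of factor with the first
    step of the next one. *)
Record nfa (A : Type) := Nfa {
  nfa_state : finType;
  nfa_init : pred nfa_state;
  nfa_final : pred nfa_state;
  nfa_step : nfa_state -> A -> pred nfa_state
}.

Fixpoint nfa_acc (A : Type) (N : nfa A) (s : nfa_state N) (w : seq A) : Prop :=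
  match w with
  | [::] => nfa_final s
  | a :: w' => exists2 s', nfa_step s a s' & nfa_acc s' w'
  end.

Definition nfa_lang (A : Type) (N : nfa A) (w : seq A) : Prop :=
  exists2 s, nfa_init s & @nfa_acc A N s w.

Section NfaOperations.
Variable A : eqType.

Definition nfa_empty : nfa A :=
  @Nfa A void (fun _ => false) (fun _ => false) (fun _ _ _ => false).

Definition nfa_eps : nfa A :=
  @Nfa A unit (fun _ => true) (fun _ => true) (fun _ _ _ => false).

Definition nfa_atom (a : A) : nfa A :=
  @Nfa A bool (fun b => ~~ b) id (fun b a' b' => [&& ~~ b, a' == a & b']).

Definition nfa_alt (N1 N2 : nfa A) : nfa A :=
  @Nfa A (nfa_state N1 + nfa_state N2)%type
    (fun s => match s with inl s => nfa_init s | inr s => nfa_init s end)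
    (fun s => match s with inl s => nfa_final s | inr s => nfa_final s end)
    (fun s a s' => match s, s' with
       | inl s, inl s' => nfa_step s a s'
       | inr s, inr s' => nfa_step s a s'
       | _, _ => false
       end).

Definition nfa_cat (N1 N2 : nfa A) : nfa A :=
  @Nfa A (nfa_state N1 + nfa_state N2)%type
    (fun s => if s is inl s then nfa_init s else false)
    (fun s => match s with
       | inl s => nfa_final s && [exists t : nfa_state N2, nfa_init t && nfa_final t]
       | inr s => nfa_final s
       end)
    (fun s a s' => match s, s' with
       | inl s, inl s' => nfa_step s a s'
       | inl s, inr t' => nfa_final s &&
           [exists t : nfa_state N2, nfa_init t && nfa_step t a t']
       | inr s, inr s' => nfa_step s a s'
       | _, _ => false
       end).

(* [None] is an additional initial state accepting the empty word. *)
Definition nfa_star (N : nfa A) : nfa A :=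
  @Nfa A (option (nfa_state N))
    (fun s => s == None)
    (fun s => if s is Some s then nfa_final s else true)
    (fun s a s' => if s' is Some s' then
       (if s is Some s then nfa_step s a s' else false) ||
       (if s is Some s then nfa_final s else true) &&
       [exists t : nfa_state N, nfa_init t && nfa_step t a s']
       else false).

Lemma nfa_acc_alt_l (N1 N2 : nfa A) (s : nfa_state N1) w :
  nfa_acc (N := nfa_alt N1 N2) (inl s) w <-> nfa_acc s w.
Proof.
elim: w s => [|a w IH] s //=; split.
  by case=> [[s'|s']] //= Hs /IH; exists s'.
by case=> s' Hs /IH; exists (inl s').
Qed.

Lemma nfa_acc_alt_r (N1 N2 : nfa A) (s : nfa_state N2) w :
  nfa_acc (N := nfa_alt N1 N2) (inr s) w <-> nfa_acc s w.
Proof.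
elim: w s => [|a w IH] s //=; split.
  by case=> [[s'|s']] //= Hs /IH; exists s'.
by case=> s' Hs /IH; exists (inr s').
Qed.

Lemma nfa_acc_cat_r (N1 N2 : nfa A) (s : nfa_state N2) w :
  nfa_acc (N := nfa_cat N1 N2) (inr s) w <-> nfa_acc s w.
Proof.
elim: w s => [|a w IH] s //=; split.
  by case=> [[s'|s']] //= Hs /IH; exists s'.
by case=> s' Hs /IH; exists (inr s').
Qed.

Lemma nfa_acc_cat_l (N1 N2 : nfa A) (s : nfa_state N1) w :
  nfa_acc (N := nfa_cat N1 N2) (inl s) w <->
  exists u v, [/\ w = u ++ v, nfa_acc s u & nfa_lang N2 v].
Proof.
elim: w s => [|a w IH] s /=.
  split.
    case/andP=> Hs /existsP [t /andP [It Ft]].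
    by exists [::], [::]; split=> //; exists t.
  case=> u [v []]; case: u v => [|//] [|//] _ Hs [t It Ft].
  by apply/andP; split=> //; apply/existsP; exists t; rewrite It.
split.
  case=> [[s'|t']] /=.
    move=> Hs /IH [u [v [-> Hu Hv]]]; exists (a :: u), v; split=> //.
    by exists s'.
  case/andP=> Hs /existsP [t /andP [It St]] /nfa_acc_cat_r Ht.
  by exists [::], (a :: w); split=> //; exists t => //; exists t'.
(* If the first factor is empty, [a] is already read by [N2], and the step taken is the one that
   leaves the final state [s]. *)
case=> [[|b u]] [v [/= E Hu Hv]].
  move: Hv; rewrite -E => -[t It [t' St Ht']]; exists (inr t').
    by rewrite Hu; apply/existsP; exists t; rewrite It.
  exact/nfa_acc_cat_r.
case: E Hu => <- E [s' Ss Hs']; exists (inl s') => //.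
by apply/IH; exists u, v.
Qed.

Definition star_lang (L : seq A -> Prop) (w : seq A) : Prop :=
  exists ws, w = flatten ws /\ forall u, u \in ws -> L u.

(** For the induction on [w], a state [Some s] stands in the middle of a factor: it accepts the rest
    of this factor followed by further factors. *)
Lemma nfa_acc_star (N : nfa A) (s : option (nfa_state N)) w :
  nfa_acc (N := nfa_star N) s w <->
  (if s is Some s then
     exists u v, [/\ w = u ++ v, nfa_acc s u & star_lang (nfa_lang N) v]
   else star_lang (nfa_lang N) w).
Proof.
(* Empty factors contribute nothing, so a nonempty word of the star begins with a nonempty factor,
   found by skipping the empty ones. *)
have start a v : star_lang (nfa_lang N) (a :: v) <->
    exists (t : nfa_state N) u v', [/\ nfa_init t, v = u ++ v', nfa_acc t (a :: u)
      & star_lang (nfa_lang N) v'].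
  split.
    case=> ws [+ Hws]; elim: ws Hws => [//|[|b u] ws IH] Hws /=.
      by move/IH; apply=> u Hu; apply: Hws; rewrite inE Hu orbT.
    case=> -> ->.
    have [|t It Ht] := Hws (b :: u); first by rewrite inE eqxx.
    exists t, u, (flatten ws); split=> //.
    by exists ws; split=> // x Hx; apply: Hws; rewrite inE Hx orbT.
  case=> t [u [v' [It -> Ht [ws [-> Hws]]]]].
  exists ((a :: u) :: ws); split=> // x; rewrite inE => /orP [/eqP ->|/Hws //].
  by exists t.
elim: w s => [|a w IH] s /=.
  case: s => [s|]; last by split=> // _; exists [::].
  split=> [Hs|[u [v []]]]; last by case: u v => [|//] [|//].
  by exists [::], [::]; split=> //; exists [::].
have startS (v : seq A) : star_lang (nfa_lang N) (a :: v) <->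
    exists2 s' : nfa_state N,
      [exists t : nfa_state N, nfa_init t && nfa_step t a s'] &
      exists u v', [/\ v = u ++ v', nfa_acc s' u & star_lang (nfa_lang N) v'].
  split.
    case/start=> t [u [v' [It -> [s' St Hs'] Hv']]].
    exists s'; first by apply/existsP; exists t; rewrite It.
    by exists u, v'.
  case=> s' /existsP [t /andP [It St]] [u [v' [-> Hu Hv]]].
  by apply/start; exists t, u, v'; split=> //; exists s'.
case: s => [s|]; last first.
  split.
    case=> [[s'|]] //= Hs /IH Hw; apply/startS; by exists s'.
  case/startS=> s' Hs' Hw; exists (Some s') => //; exact/IH.
split.
  case=> [[s'|]] //= /orP [Hs|/andP [Fs Hs]] /IH Hw.
    case: Hw => u [v [-> Hu Hv]]; exists (a :: u), v; split=> //.
    by exists s'.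
  exists [::], (a :: w); split=> //; apply/startS; by exists s'.
case=> [[|b u]] [v [/= E Hu Hv]].
  move: Hv; rewrite -E => /startS [s' Hs' Hw]; exists (Some s'); last exact/IH.
  by rewrite Hu Hs' orbT.
case: E Hu => <- E [s' Ss Hs']; exists (Some s'); first by rewrite Ss.
by apply/IH; exists u, v.
Qed.

Lemma regex_nfa (r : regex A) :
  exists N : nfa A, forall w, re_lang r w <-> nfa_lang N w.
Proof.
elim: r => [||a|r1 [N1 H1] r2 [N2 H2]|r1 [N1 H1] r2 [N2 H2]|r [N H]] /=.
- by exists nfa_empty => w; split=> // -[[]].
- exists nfa_eps => -[|a w]; split=> //; first by move=> _; exists tt.
  by case=> s _ [].
- exists (nfa_atom a) => w; split.
    by move=> ->; exists false => //; exists true => //=; rewrite eqxx.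
  case=> -[] // _; case: w => [//|b w] /= [s' /andP [/eqP -> Hs']].
  by rewrite Hs'; case: w => [|c w] // [].
- exists (nfa_cat N1 N2) => w; split.
    case=> u [v [-> /H1 [s Is Hs] /H2 Hv]]; exists (inl s) => //.
    by apply/nfa_acc_cat_l; exists u, v.
  case=> [[s|//]] /= Is /nfa_acc_cat_l [u [v [-> Hu Hv]]].
  exists u, v; split=> //; last exact/H2.
  by apply/H1; exists s.
- exists (nfa_alt N1 N2) => w; split.
    case=> [/H1|/H2] [s Is Hs].
      by exists (inl s) => //; apply/nfa_acc_alt_l.
    by exists (inr s) => //; apply/nfa_acc_alt_r.
  case=> [[s|s]] /= Is.
    by move/nfa_acc_alt_l=> Hs; left; apply/H1; exists s.
  by move/nfa_acc_alt_r=> Hs; right; apply/H2; exists s.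
- exists (nfa_star N) => w; split.
    case=> ws [-> Hws]; exists None => //; apply/nfa_acc_star.
    by exists ws; split=> // u /Hws /H.
  case=> [[s|]] // _ /nfa_acc_star [ws [-> Hws]].
  by exists ws; split=> // u /Hws /H.
Qed.

End NfaOperations.

(** * Acceptance as a backward recursion *)

Definition event (R : realType) (G : Type) (rho : timed_word R G)
    (k : position rho) : R * G := (tw_time k, tw_lab k).

Lemma drop_enum_ord (n : nat) (k : 'I_n) :
  drop k (enum 'I_n) = k :: drop k.+1 (enum 'I_n).
Proof.
by rewrite (drop_nth k) ?nth_ord_enum // size_enum_ord ltn_ord.
Qed.

Lemma ata_sat_mono (R : realType) (Q : finType) (nu : R) (M M' : {set Q + Q})
    (phi : ata_form Q) :
  M \subset M' -> ata_sat nu M phi -> ata_sat nu M' phi.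
Proof.
move=> /subsetP sub; elim: phi => //= [p IHp q IHq|p IHp q IHq|q|q].
- by case/andP=> /IHp -> /IHq ->.
- by case/orP=> [/IHp ->|/IHq ->] //; rewrite orbT.
- exact: sub.
- exact: sub.
Qed.

Section Acceptance.
Variables (R : realType) (G : Type) (A : ata G).
Implicit Types (w : seq (R * G)) (q : ata_loc A) (r t : R).

(** Used with the winning targets: transition formulas are positive, so taking all of them succeeds
    whenever some choice among them does. *)
Definition ata_targets (T : finType) (here reset : pred T) : {set T + T} :=
  [set x | match x with inl p => here p | inr p => reset p end].

(* [r] is the time of the last reset, so the clock shows [t - r] at time [t]. *)
Fixpoint ata_win w q r : bool :=
  if w is (t, a) :: w' then
    ata_sat (t - r) (ata_targets (fun p => ata_win w' p r) (fun p => ata_win w' p t))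
      (ata_delta q a)
  else q \in ata_final A.

Variable rho : timed_word R G.
Let n := tw_last rho.
Let ev (k : nat) := map (@event R G rho) (drop k (enum (position rho))).
(** Valuations in the [k]-th configuration are those right after the previous event, whose time this
    is; subtracting a valuation from it gives the time of the last reset. *)
Let clock (k : nat) : R :=
  if k == 0%N then 0 else tw_time (inord k.-1 : position rho).

Let ev_cons (k : position rho) : ev k = event k :: ev k.+1.
Proof. by rewrite /ev drop_enum_ord. Qed.

Let ev_last : ev n.+1 = [::].
Proof. by rewrite /ev drop_oversize // size_enum_ord. Qed.

Let clockS (k : position rho) : clock k.+1 = tw_time k.
Proof. by rewrite /clock /= inord_val. Qed.

Let reset_elapse (k : position rho) (x : R) :
  tw_time k - (x + (tw_time k - prev_time k)) = clock k - x.
Proof.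
rewrite /prev_time -/(clock k) opprD opprB addrCA [tw_time k + _]addrC subrK.
by rewrite addrC.
Qed.

Definition winning_config (k : nat) (C : config R A) : Prop :=
  forall c, c \in C -> ata_win (ev k) c.1 (clock k - c.2).

Let elapsed_win (k : position rho) (C : config R A) :
  winning_config k C <->
  forall c, c \in elapse C (tw_time k - prev_time k) ->
    ata_sat c.2 (ata_targets (fun p => ata_win (ev k.+1) p (tw_time k - c.2))
      (fun p => ata_win (ev k.+1) p (tw_time k))) (ata_delta c.1 (tw_lab k)).
Proof.
split=> [win c /imfsetP [c' /= Cc' ->] /=|win c Cc].
  by have := win c' Cc'; rewrite ev_cons /= -reset_elapse subKr.
rewrite ev_cons /= -reset_elapse subKr.
by apply: (win (c.1, _)); apply/imfsetP; exists c.
Qed.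

(** The targets chosen by the successor are all winning, so monotonicity passes from the choice to
    the full set of winning targets. *)
Let winning_config_pred (k : position rho) (C C' : config R A) :
  successor (tw_lab k) (elapse C (tw_time k - prev_time k)) C' ->
  winning_config k.+1 C' -> winning_config k C.
Proof.
case=> M [satM CM] win; apply/elapsed_win => c Ec.
apply: ata_sat_mono (satM c Ec); apply/subsetP => -[p|p] Mp; rewrite inE.
  rewrite -clockS; apply: (win (p, c.2)); apply/CM; exists c; split=> //.
  by left.
rewrite -clockS -[X in ata_win _ _ X]subr0; apply: (win (p, 0)); apply/CM.
by exists c; split=> //; right.
Qed.

Let all_targets (k : position rho) (c : ata_loc A * R) := ata_targets
  (fun p => ata_win (ev k.+1) p (tw_time k - c.2))
  (fun p => ata_win (ev k.+1) p (tw_time k)).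

Let target (c : ata_loc A * R) (x : ata_loc A + ata_loc A) :=
  match x with inl p => (p, c.2) | inr p => (p, 0) end.

Let next_config (k : position rho) (C : config R A) : config R A :=
  [fset x in [seq target c x |
    c <- enum_fset (elapse C (tw_time k - prev_time k)),
    x <- enum (all_targets k c)]].

Let winning_next (k : position rho) (C : config R A) :
  winning_config k C ->
  successor (tw_lab k) (elapse C (tw_time k - prev_time k)) (next_config k C) /\
  winning_config k.+1 (next_config k C).
Proof.
move=> /elapsed_win win; set E := elapse _ _ in win *.
have CP p nu : (p, nu) \in next_config k C <-> exists c, c \in E /\
    ((inl p \in all_targets k c /\ nu = c.2) \/
     (inr p \in all_targets k c /\ nu = 0)).
  rewrite inE /=; split.
    case/allpairsPdep=> c [[q|q]] [Ec]; rewrite mem_enum => Mq [-> ->].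
      by exists c; split=> //; left.
    by exists c; split=> //; right.
  case=> c [Ec [[Mp ->]|[Mp ->]]]; apply/allpairsPdep.
    by exists c, (inl p); rewrite mem_enum.
  by exists c, (inr p); rewrite mem_enum.
split; first by exists (all_targets k).
case=> p nu /CP [c [_ []]]; rewrite inE => -[Mp ->]; rewrite clockS //=.
by rewrite subr0.
Qed.

(** The states of a configuration evolve independently, so a configuration can be continued to
    acceptance iff each of its states wins separately. *)
Lemma acceptsP :
  accepts A rho <-> ata_win (map (@event R G rho) (enum (position rho))) (ata_init A) 0.
Proof.
have init0 : winning_config 0 [fset (ata_init A, 0)] <->
    ata_win (map (@event R G rho) (enum (position rho))) (ata_init A) 0.
  rewrite /winning_config /ev drop0 /clock eqxx; split=> [|win c].
    by move=> /(_ (ata_init A, 0)); rewrite subr0; apply; rewrite inE.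
  by rewrite inE => /eqP ->; rewrite subr0.
apply: (iff_trans _ init0); split.
  case=> C [[C0 stepC] finC]; rewrite -C0.
  have lastC : winning_config n.+1 (C n.+1).
    by move=> c /finC; rewrite ev_last.
  (* Induction from the end of the word: [m] counts the events still to be read. *)
  suff: forall m, (m <= n.+1)%N -> winning_config (n.+1 - m) (C (n.+1 - m)%N).
    by move/(_ n.+1 (leqnn _)); rewrite subnn.
  elim=> [|m IH] lemn; first by rewrite subn0.
  have ltk : (n.+1 - m.+1 < n.+1)%N by rewrite ltn_subrL.
  have /(winning_config_pred (k := Ordinal ltk)) := stepC (Ordinal ltk).
  by apply=> /=; rewrite subnSK //; apply/IH/ltnW.
move=> win0.
(* The run keeps all winning targets at each step. Past the last position [inord k] is a default
   value, but there a run is unconstrained. *)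
pose C := nat_rect (fun _ => config R A) [fset (ata_init A, 0)]
  (fun k => next_config (inord k)).
have winC (k : nat) : (k <= n.+1)%N -> winning_config k (C k).
  elim: k => [//|k IH] ltk; have Ek : (inord k : position rho) = k :> nat by rewrite inordK.
  have [|_] := @winning_next (inord k) (C k); first by rewrite Ek; apply/IH/ltnW.
  by rewrite {1}Ek.
exists C; split; first split=> // k.
  have /winning_next [] := winC k (ltnW (ltn_ord k)).
  by rewrite /= inord_val.
by move=> c /(winC n.+1 (leqnn _)); rewrite ev_last.
Qed.

End Acceptance.

(** * Readings of sequences of positions *)

(** Merges the choice of formulas with the run of the automaton, so that both unfold along the
    positions as [holds] does. *)
Fixpoint nfa_reads (A : Type) (T : Type) (N : nfa A) (H : A -> T -> Prop)
    (s : nfa_state N) (ps : seq T) : Prop :=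
  match ps with
  | [::] => nfa_final s
  | k :: ps' => exists a s', [/\ nfa_step s a s', H a k & nfa_reads H s' ps']
  end.

Lemma reads_nfa (T : eqType) (n : nat) (re : regex 'I_n) (N : nfa 'I_n)
    (H : 'I_n -> T -> Prop) (ps : seq T) :
  (forall w, re_lang re w <-> nfa_lang N w) ->
  reads re H ps <-> exists2 s : nfa_state N, nfa_init s & nfa_reads H s ps.
Proof.
move=> reN.
have runs (s : nfa_state N) : nfa_reads H s ps <->
    exists w, [/\ nfa_acc s w, size w = size ps &
      forall a k, (a, k) \in zip w ps -> H a k].
  elim: ps s => [|k ps IH] s /=.
    split=> [Fs|[w []]]; first by exists [::].
    by case: w.
  split.
    case=> a [s' [st Hak /IH [w [acc sz Hw]]]]; exists (a :: w); split=> /=.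
    - by exists s'.
    - by rewrite sz.
    - by move=> b j; rewrite inE => /orP [/eqP [-> ->] //|/Hw].
  case=> -[|a w] [] //= [s' st acc] [sz] Hw; exists a, s'; split=> //.
    by apply: Hw; rewrite inE eqxx.
  apply/IH; exists w; split=> // b j wb; apply: Hw; by rewrite inE wb orbT.
split.
  by case=> w [/reN [s Is acc] sz Hw]; exists s => //; apply/runs; exists w.
case=> s Is /runs [w [acc sz Hw]]; exists w; split=> //.
by apply/reN; exists s.
Qed.

Section OrdinalSuffixes.
Variable n : nat.
Implicit Types (i j x : 'I_n) (ps : seq 'I_n).

Lemma pairwise_enum_ord : pairwise (fun i j => (i < j)%N) (enum 'I_n).
Proof.
rewrite -(pairwise_map (@nat_of_ord n) ltn).
by rewrite val_enum_ord -sorted_pairwise ?iota_ltn_sorted //; apply: ltn_trans.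
Qed.

Lemma drop_enum_ord_cons (k : nat) x ps :
  drop k (enum 'I_n) = x :: ps -> x = k :> nat /\ ps = drop x.+1 (enum 'I_n).
Proof.
move=> E; have ltk : (k < n)%N.
  by rewrite ltnNge; apply/negP => len; move: E; rewrite drop_oversize ?size_enum_ord.
by move: E; rewrite (drop_enum_ord (Ordinal ltk)) => -[<- <-].
Qed.

Lemma enum_ord_split i ps1 j ps2 :
  drop i.+1 (enum 'I_n) = ps1 ++ j :: ps2 ->
  (i < j)%N /\ [seq k : 'I_n <- enum 'I_n | (i < k < j)%N] = ps1.
Proof.
move=> E; have := pairwise_enum_ord.
rewrite -{1}(cat_take_drop i (enum 'I_n)) drop_enum_ord E.
rewrite pairwise_cat pairwise_cons pairwise_cat pairwise_cons all_cat /= allrel_consr.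
case/and3P=> /andP [/allP lt_i _] _ /andP [/and3P [/allP i1 ij /allP i2]].
rewrite allrel_consr.
case/and3P=> /andP [/allP lt_j _] _ /andP [/allP j2 _]; split=> //.
rewrite -{1}(cat_take_drop i (enum 'I_n)) drop_enum_ord E.
rewrite filter_cat /= ltnn /= filter_cat /= ltnn andbF.
rewrite (eq_in_filter (a2 := pred0)); last first.
  by move=> k /lt_i ki; rewrite /= ltnNge (ltnW ki).
rewrite filter_pred0 (eq_in_filter (a2 := predT)); last first.
  by move=> k k1 /=; rewrite i1 ?lt_j.
rewrite filter_predT (eq_in_filter (a2 := pred0)) ?filter_pred0 ?cats0 //.
by move=> k /j2 jk; rewrite /= (ltnNge k) (ltnW jk) andbF.
Qed.

(** Replaces the positions between [i] and [j] by a prefix of the suffix after [i], on which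
    induction along the word is possible. *)
Lemma enum_ord_splitP i (P : 'I_n -> seq 'I_n -> Prop) :
  (exists j, (i < j)%N /\ P j [seq k : 'I_n <- enum 'I_n | (i < k < j)%N]) <->
  exists ps1 j ps2, drop i.+1 (enum 'I_n) = ps1 ++ j :: ps2 /\ P j ps1.
Proof.
split; last first.
  by case=> ps1 [j [ps2 [/enum_ord_split [ij <-] Pj]]]; exists j.
case=> j [ij Pj].
have : j \in drop i.+1 (enum 'I_n).
  have: j \in enum 'I_n by rewrite mem_enum.
  rewrite -{1}(cat_take_drop i.+1 (enum 'I_n)) mem_cat => /orP [|//].
  rewrite in_take ?mem_enum // index_enum_ord ltnNge.
  by rewrite ij.
case/splitPr E: _ / => [ps1 ps2]; exists ps1, j, ps2; split=> //.
by have [_ <-] := enum_ord_split E.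
Qed.

Lemma filter_enum_ord_from i (a : pred 'I_n) :
  [seq k : 'I_n <- enum 'I_n | (i <= k)%N && a k] =
  [seq k <- drop i (enum 'I_n) | a k].
Proof.
have := pairwise_enum_ord; rewrite -{1 2}(cat_take_drop i (enum 'I_n)).
rewrite drop_enum_ord pairwise_cat pairwise_cons allrel_consr.
case/and3P=> /andP [/allP lt_i _] _ /andP [/allP i_lt _].
rewrite filter_cat (eq_in_filter (a2 := pred0)); last first.
  by move=> k /lt_i ki; rewrite /= leqNgt ki.
rewrite filter_pred0 /= leqnn /=; case: ifP => _; [congr cons|];
by apply: eq_in_filter => k /i_lt ik /=; rewrite ltnW.
Qed.

End OrdinalSuffixes.

(** * Systems of future predicates *)

Inductive clause_head (Q : Type) :=
| HLoc of Q
| HClock of interval nat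
| HBoth of interval nat & Q.

Arguments HClock {Q}.

(* A clause is the conjunction of its head with an arbitrary Boolean function of
   the set of locations that can be started by a reset at the current position.
   As this function need not be monotone, negation comes for free; it is
   compiled away at the end by doubling the locations. *)
Definition clause (Q : finType) := (clause_head Q * pred {set Q})%type.

Record system (G : Type) := System {
  loc : finType;
  loc_final : pred loc;
  loc_delta : loc -> G -> seq (clause loc)
}.

Definition head_holds (R : realType) (Q : Type) (nu : R) (here : pred Q)
    (h : clause_head Q) : bool :=
  match h with
  | HLoc q => here q
  | HClock J => in_nat_itv nu J
  | HBoth J q => in_nat_itv nu J && here q
  end.

Section Values.
Variables (R : realType) (G : Type) (s : system G).

(** As in [ata_win], [r] is the time of the last reset. The location in a head keeps [r], while the
    Boolean part of a clause sees the locations reset at [t]. *)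
Fixpoint holds (w : seq (R * G)) (q : loc s) (r : R) : bool :=
  if w is (t, a) :: w' then
    has (fun c : clause (loc s) =>
           head_holds (t - r) (fun p => holds w' p r) c.1 &&
           c.2 [set p | holds w' p t])
      (loc_delta q a)
  else loc_final q.

Definition started (w : seq (R * G)) (t : R) : {set loc s} :=
  [set p | holds w p t].

End Values.

Definition is_both (Q : Type) (h : clause_head Q) : bool :=
  if h is HBoth _ _ then true else false.

Definition unmixed (G : Type) (s : system G) : Prop :=
  forall (q : loc s) a, all (fun c => ~~ is_both c.1) (loc_delta q a).

Definition map_head (Q Q' : Type) (f : Q -> Q') (h : clause_head Q) : clause_head Q' :=
  match h with
  | HLoc q => HLoc (f q)
  | HClock J => HClock J
  | HBoth J q => HBoth J (f q)
  end.

Definition map_clause (Q Q' : finType) (f : Q -> Q') (c : clause Q) : clause Q' :=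
  (map_head f c.1, fun X : {set Q'} => c.2 (f @^-1: X)).

Lemma unmixed_map_clause (Q Q' : finType) (f : Q -> Q') (cs : seq (clause Q)) :
  all (fun c => ~~ is_both c.1) (map (map_clause f) cs) =
  all (fun c => ~~ is_both c.1) cs.
Proof. by rewrite all_map; apply: eq_all => -[[]]. Qed.

(** * Embedding and combining systems *)

Section Embedding.
Variables (R : realType) (G : Type) (s s' : system G) (f : loc s -> loc s').
Hypothesis f_final : forall q, loc_final (f q) = loc_final q.
Hypothesis f_delta : forall q a,
  loc_delta (f q) a = map (map_clause f) (loc_delta q a).

(** The image of [f] is closed under transitions, so locations outside it have no influence on the
    values inside. *)
Lemma holds_embed (w : seq (R * G)) q r : holds w (f q) r = holds w q r.
Proof.
elim: w q r => [|[t a] w IH] q r /=; first exact: f_final.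
rewrite f_delta has_map; apply: eq_has => -[h b] /=.
have -> : f @^-1: [set p | holds w p t] = [set p | holds w p t].
  by apply/setP => p; rewrite !inE IH.
by case: h => [p|I|I p] /=; rewrite ?IH.
Qed.

Lemma started_embed (w : seq (R * G)) t :
  f @^-1: started s' w t = started s w t.
Proof. by apply/setP => p; rewrite !inE holds_embed. Qed.

End Embedding.

Definition join_system (G : Type) (J : finType) (s : J -> system G) : system G :=
  @System G {j : J & loc (s j)}
    (fun q => loc_final (tagged q))
    (fun q a => map (map_clause (@Tagged J (tag q) (fun j => loc (s j))))
                  (loc_delta (tagged q) a)).

Definition extend_system (G : Type) (s : system G) (S : finType) (fin : pred S)
    (delta : S -> G -> seq (clause (loc s + S)%type)) : system G :=
  @System G (loc s + S)%type
    (fun q => match q with inl q => loc_final q | inr q => fin q end)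
    (fun q a => match q with
       | inl q => map (map_clause inl) (loc_delta q a)
       | inr q => delta q a
       end).

Lemma in_nat_itv_out (R : realType) (t : R) (l u : itv_bound nat) :
  in_nat_itv t (Interval -oo%O l) || in_nat_itv t (Interval u +oo%O) =
  ~~ in_nat_itv t (Interval l u).
Proof.
rewrite /in_nat_itv /= !itv_boundlr /=.
case: l u => [[] l|[]] [[] u|[]] //=; rewrite ?bnd_simp //;
by rewrite ?(andbT, orbF, orbT, andbF, negb_and) -?ltNge -?leNgt.
Qed.

Lemma in_nat_itv0 (R : realType) (I : interval nat) :
  in_nat_itv (0 : R) I = (0%N \in I).
Proof.
case: I => l u; rewrite /in_nat_itv -[0 : R]/(0%:R) !itv_boundlr /=.
by case: l u => [[] l|[]] [[] u|[]] //=; rewrite ?bnd_simp ?(ler_nat, ltr_nat).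
Qed.

(** * Formulas as systems *)

Section Representation.
Variables (R : realType) (Sigma V : finType).
Local Notation G := (letter Sigma * {set V})%type.
Implicit Types (s : system G) (phi : formula Sigma V).

Definition future (H : Type) (rho : timed_word R H) (k : nat) : seq (R * H) :=
  map (@event R H rho) (drop k (enum (position rho))).

(** The second component is the semantic content of guardedness: the value at a position ignores the
    label there of a guarded variable. All super structures are covered because fixpoints change the
    labels. *)
Definition represents phi s (now : G -> pred {set loc s}) : Prop :=
  (forall (rho : super_structure R Sigma V) (i : position rho),
     sat phi i <-> now (tw_lab i) (started s (future rho i.+1) (tw_time i))) /\
  (forall z, guarded_var z phi -> forall a S, now (a, S :\ z) =1 now (a, S)).

Definition representable phi : Prop :=
  exists s now, @represents phi s now /\ (rat_free phi -> unmixed s).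

Lemma join_represents (J : finType) (F : J -> formula Sigma V) :
  (forall j, representable (F j)) ->
  exists (s : system G) (now : J -> G -> pred {set loc s}),
    (forall j, represents (F j) (now j)) /\
    ((forall j, rat_free (F j)) -> unmixed s).
Proof.
move=> repF.
(* Pairing each system with its [now] turns the simultaneous choice over the finite type [J] into a
   single one. *)
have /fin_all_exists [sn repsn] (j : J) : exists sn : {s : system G & G -> pred {set loc s}},
    represents (F j) (projT2 sn) /\ (rat_free (F j) -> unmixed (projT1 sn)).
  by have [s [now H]] := repF j; exists (existT _ s now).
pose s j := projT1 (sn j).
pose inj j : loc (s j) -> loc (join_system s) := @Tagged J j (fun j => loc (s j)).
exists (join_system s), (fun j a (X : {set loc (join_system s)}) =>
  projT2 (sn j) a (inj j @^-1: X)).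
split=> [j|free q a /=].
  have [[repj gj] _] := repsn j; split=> [rho i|z gz a S X]; last exact: gj.
  by rewrite started_embed.
by rewrite unmixed_map_clause; have [_ ->] := repsn (tag q).
Qed.

Definition void_system : system G :=
  @System G void (fun _ => false) (fun _ _ => [::]).

Lemma void_system_represents phi (now : G -> bool) :
  (forall (rho : super_structure R Sigma V) (i : position rho),
     sat phi i <-> now (tw_lab i)) ->
  (forall z, guarded_var z phi -> forall a S, now (a, S :\ z) = now (a, S)) ->
  representable phi.
Proof.
move=> satP gP; exists void_system, (fun a _ => now a); split=> //.
by split=> // z gz a S X; apply: gP.
Qed.

Lemma representable_neg phi : representable phi -> representable (FNeg phi).
Proof.
case=> s [now [[satP gP] um]]; exists s, (fun a X => ~~ now a X); split=> //.
split=> [rho i|z gz a S X] /=; last by rewrite gP.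
by rewrite satP; split=> /negP.
Qed.

Lemma representable_and phi psi :
  representable phi -> representable psi -> representable (FAnd phi psi).
Proof.
move=> rphi rpsi.
have [|s [now [rep um]]] := @join_represents bool (fun b => if b then phi else psi).
  by case.
exists s, (fun a X => now true a X && now false a X); split.
  have [satT gT] := rep true; have [satF gF] := rep false.
  split=> [rho i|z [gz gz'] a S X] /=; last by rewrite gT ?gF.
  by rewrite satT satF; split=> [[-> ->]|/andP []].
by case=> f1 f2; apply: um; case.
Qed.

Definition old_part s (S : finType) (X : {set loc s + S}) : {set loc s} :=
  inl @^-1: X.

Lemma started_extend s (S : finType) (fin : pred S) delta (w : seq (R * G)) t :
  old_part (started (@extend_system G s S fin delta) w t) = started s w t.
Proof. exact: (@started_embed R G s (extend_system fin delta) inl). Qed.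

(* The extra location [inr x] means: the positions strictly after the reset can
   be read from state [x] up to one satisfying [phi] at which the clock is in [J]. *)
Section FRatSystem.
Variables (s : system G) (n : nat) (N : nfa 'I_n) (J : interval nat).
Variables (nowF : 'I_n -> G -> pred {set loc s}) (nowP : G -> pred {set loc s}).

Definition frat_delta (x : nfa_state N) (a : G) :
    seq (clause (loc s + nfa_state N)%type) :=
  [seq (HLoc (inr y.2), fun X => nowF y.1 a (old_part X)) |
     y <- enum {: 'I_n * nfa_state N} & nfa_step x y.1 y.2] ++
  nseq (nfa_final x) (HClock J, fun X => nowP a (old_part X)).

Definition frat_system : system G := @extend_system G s (nfa_state N) pred0 frat_delta.

Lemma holds_frat (Fs : 'I_n -> formula Sigma V) phi
    (rho : super_structure R Sigma V) (k : nat) (x : nfa_state N) (r : R) :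
  (forall a, represents (Fs a) (nowF a)) -> represents phi nowP ->
  holds (s := frat_system) (future rho k) (inr x) r <->
  exists ps1 j ps2, [/\ drop k (enum (position rho)) = ps1 ++ j :: ps2,
    sat phi j, in_nat_itv (tw_time j - r) J &
    nfa_reads (fun a (i : position rho) => sat (Fs a) i) x ps1].
Proof.
move=> repF repP; rewrite /future.
move Eps: (drop k _) => ps; elim: ps k Eps x => [|i ps IH] k Eps x.
  by split=> // -[[|? ?] [? [? []]]].
have [_ Eps'] := drop_enum_ord_cons Eps.
rewrite [holds _ _ _]/= has_cat has_map has_nseq /=.
have satF a : nowF a (tw_lab i)
    (old_part [set p | holds (s := frat_system) (map (@event _ _ rho) ps) p (tw_time i)])
    <-> sat (Fs a) i.
  by rewrite -/(started _ _ _) started_extend Eps'; have [-> _] := repF a.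
have satP : nowP (tw_lab i)
    (old_part [set p | holds (s := frat_system) (map (@event _ _ rho) ps) p (tw_time i)])
    <-> sat phi i.
  by rewrite -/(started _ _ _) started_extend Eps'; have [-> _] := repP.
split.
  case/orP.
    case/hasP=> -[a y]; rewrite mem_filter /= => /andP [st _].
    case/andP=> /(IH _ (esym Eps')) [ps1 [j [ps2 [E Pj Ij rd]]]] /satF Fi.
    by exists (i :: ps1), j, ps2; rewrite E; split=> //; exists a, y.
  case/and3P; rewrite lt0b => Fx Ii /satP Pi.
  by exists [::], i, ps.
case=> -[|i' ps1] [j [ps2 [/= [Ei E] Pj Ij rd]]].
  by move: Pj Ij; rewrite -Ei lt0b rd => /satP -> -> /=; rewrite orbT.
move: rd; rewrite -Ei /= => -[a [y [st Fi rd]]].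
apply/orP; left; apply/hasP; exists (a, y); first by rewrite mem_filter /= st mem_enum.
apply/andP; split; last exact/satF.
by apply/(IH _ (esym Eps')); exists ps1, j, ps2.
Qed.

End FRatSystem.

Lemma representable_frat J n (Fs : 'I_n -> formula Sigma V) re phi :
  (forall a, representable (Fs a)) -> representable phi ->
  representable (FRat J Fs re phi).
Proof.
move=> rF rphi.
have [|s [now [rep um]]] :=
  @join_represents (option 'I_n) (fun o => if o is Some a then Fs a else phi).
  by case.
have [N reN] := regex_nfa re.
exists (frat_system N J (fun a => now (Some a)) (now None)).
exists (fun _ (X : {set loc s + nfa_state N}) =>
  [exists x : nfa_state N, nfa_init x && (inr x \in X)]).
split; last first.
  case=> freeF freeP; have {um} um : unmixed s by apply: um; case.
  case=> [q|x] a /=.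
    by rewrite unmixed_map_clause um.
  by rewrite all_cat all_map all_nseq orbT andbT; apply/allP.
(* The chosen [now] ignores the current letter, which settles guardedness at once: [FRat] is a
   strict-future modality. *)
split=> // rho i.
rewrite [sat _ _]/= /frat_sem.
pose P (j : position rho) (ps : seq (position rho)) := [/\ sat phi j,
  in_nat_itv (tw_time j - tw_time i) J &
  reads re (fun a (k : position rho) => sat (Fs a) k) ps].
apply: (iff_trans (B := exists j : position rho, (i < j)%N /\
    P j [seq k : position rho <- enum (position rho) | (i < k < j)%N])).
  by split=> [[j [? ? ? ?]]|[j [? [? ? ?]]]]; exists j.
apply: (iff_trans (enum_ord_splitP i P)).
have hold x := @holds_frat s n N J (fun a => now (Some a)) (now None) Fs phi
  rho i.+1 x (tw_time i) (fun a => rep (Some a)) (rep None).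
split.
  case=> ps1 [j [ps2 [E [Pj Ij /(reads_nfa _ _ reN) [x Ix rd]]]]].
  apply/existsP; exists x; rewrite Ix inE; apply/hold.
  by exists ps1, j, ps2.
case/existsP=> x /andP [Ix]; rewrite inE => /hold [ps1 [j [ps2 [E Pj Ij rd]]]].
exists ps1, j, ps2; split=> //; split=> //; apply/(reads_nfa _ _ reN).
by exists x.
Qed.
(* The extra location [inr x] reads from state [x] the positions at which the
   clock is in [J] and waits at the others. *)
Section RatSystem.
Variables (s : system G) (n : nat) (N : nfa 'I_n) (J : interval nat).
Variable nowF : 'I_n -> G -> pred {set loc s}.

(** Every clause tests the clock and also keeps it running, and this is why [Rat] leaves the
    conjunctive-disjunctive class. *)
Definition rat_delta (x : nfa_state N) (a : G) :
    seq (clause (loc s + nfa_state N)%type) :=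
  let: Interval l u := J in
  [:: (HBoth (Interval -oo%O l) (inr x), xpredT),
      (HBoth (Interval u +oo%O) (inr x), xpredT) &
    [seq (HBoth J (inr y.2), fun X => nowF y.1 a (old_part X)) |
       y <- enum {: 'I_n * nfa_state N} & nfa_step x y.1 y.2]].

Definition rat_system : system G :=
  @extend_system G s (nfa_state N) (@nfa_final _ N) rat_delta.

(** If 0 is in [J], the current position is the first one listed, so the first step of [N] is made
    at once with the current letter; the started location only reads later positions. *)
Definition rat_now (a : G) (X : {set loc rat_system}) : bool :=
  if 0%N \in J then
    [exists x : nfa_state N, [exists y : 'I_n * nfa_state N,
      [&& nfa_init x, nfa_step x y.1 y.2, nowF y.1 a (old_part X) & inr y.2 \in X]]]
  else [exists x : nfa_state N, nfa_init x && (inr x \in X)].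

Variables (Fs : 'I_n -> formula Sigma V) (rho : super_structure R Sigma V).
Hypothesis repF : forall a, represents (Fs a) (nowF a).
Let H (a : 'I_n) (i : position rho) := sat (Fs a) i.

Lemma rat_nowF (i : position rho) a :
  nowF a (tw_lab i)
    (old_part (started rat_system (future rho i.+1) (tw_time i))) <-> H a i.
Proof.
by rewrite started_extend /H; have [-> _] := repF a.
Qed.

Lemma holds_rat (k : nat) (x : nfa_state N) (r : R) :
  holds (s := rat_system) (future rho k) (inr x) r <->
  nfa_reads H x [seq i : position rho <- drop k (enum (position rho)) |
    in_nat_itv (tw_time i - r) J].
Proof.
rewrite /future.
move Eps: (drop k _) => ps; elim: ps k Eps x => [//|i ps IH] k Eps x.
have [_ Eps'] := drop_enum_ord_cons Eps.
have nowP a := rat_nowF i a; rewrite /future -Eps' in nowP.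
rewrite [holds _ _ _]/= /rat_delta; case EJ: J => [l u].
(* The two waiting clauses together say that the clock is outside [J]. *)
rewrite /= has_map !andbT orbA -andb_orl in_nat_itv_out -EJ.
case: ifP => Ii /=; last first.
  split=> [/orP [/(IH _ (esym Eps')) //|/hasP [y _] /=]|rd].
    by rewrite Ii.
  by apply/orP; left; apply/(IH _ (esym Eps')).
split.
  case/hasP=> -[a y]; rewrite mem_filter /= Ii => /andP [st _].
  by case/andP=> /(IH _ (esym Eps')) rd /nowP Fi; exists a, y.
case=> a [y [st Fi rd]]; apply/hasP; exists (a, y).
  by rewrite mem_filter /= st mem_enum.
rewrite /= Ii /=; apply/andP; split; last exact/nowP.
exact/(IH _ (esym Eps')).
Qed.

End RatSystem.

Lemma representable_rat J n (Fs : 'I_n -> formula Sigma V) re :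
  (forall a, representable (Fs a)) -> representable (Defs.Rat J Fs re).
Proof.
move=> rF; have [s [now [rep _]]] := @join_represents 'I_n Fs rF.
have [N reN] := regex_nfa re.
exists (rat_system N J now), (@rat_now s n N J now); split=> //.
split=> [rho i|z gz a S X]; last first.
  (* The current letter matters only if 0 is in [J], and then [z] is guarded in every [Fs a]. *)
  rewrite /rat_now; case: ifP => // J0.
  case: gz => [/negP //|gz]; apply: eq_existsb => x; apply: eq_existsb => y.
  by have [_ g] := rep y.1; rewrite g; last exact: gz.
rewrite [sat _ _]/= /rat_sem filter_enum_ord_from drop_enum_ord /= subrr in_nat_itv0.
apply: (iff_trans (reads_nfa _ _ reN)); rewrite /rat_now.
have hold x := @holds_rat s n N J now Fs rho rep i.+1 x (tw_time i).
have nowP a := @rat_nowF s n N J now Fs rho rep i a.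
case: ifP => J0; split.
- case=> x Ix [a [y [st Fi /hold rd]]].
  apply/existsP; exists x; apply/existsP; exists (a, y) => /=.
  by rewrite Ix st inE rd andbT; apply/nowP.
- case/existsP=> x /existsP [[a y] /and4P [Ix st /nowP Fi]].
  by rewrite inE => /hold rd; exists x => //; exists a, y.
- by case=> x Ix /hold rd; apply/existsP; exists x; rewrite Ix inE.
- by case/existsP=> x /andP [Ix]; rewrite inE => /hold rd; exists x.
Qed.

(* Reading a letter, the truth value of [z] at the current position is that of
   the body, which by guardedness does not depend on [z] at this position. *)
Section FixSystem.
Variables (s : system G) (z : V) (now : G -> pred {set loc s}).

Definition fix_now (a : G) : pred {set loc s} := now (a.1, a.2 :\ z).

(** Both possible labels for [z] are tried, each conjoined with the matching value of the body, so
    exactly one of the two groups of clauses is active. *)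
Definition fix_delta (q : loc s) (a : G) : seq (clause (loc s)) :=
  [seq (c.1, fun X => c.2 X && fix_now a X) | c <- loc_delta q (a.1, z |: a.2)] ++
  [seq (c.1, fun X => c.2 X && ~~ fix_now a X) | c <- loc_delta q (a.1, a.2 :\ z)].

Definition fix_system : system G := System (@loc_final _ s) fix_delta.

Variables (phi : formula Sigma V) (rho : super_structure R Sigma V).
Hypotheses (rep : represents phi now) (gz : guarded_var z phi).

Definition fix_set : {set position rho} :=
  [set i | fix_now (tw_lab i) (started fix_system (future rho i.+1) (tw_time i))].

(** Values at [k] depend only on the events from [k] on, so [X] has to be correct only there; this
    weak hypothesis is what the backward induction can supply. *)
Lemma holds_fix_system (X : {set position rho}) (k : nat) (q : loc s) r :
  (forall i : position rho, (k <= i)%N -> (i \in X) = (i \in fix_set)) ->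
  holds (s := fix_system) (future rho k) q r =
  holds (s := s) (future (set_var rho z X) k) q r.
Proof.
rewrite /future.
move Eps: (drop k _) => ps; elim: ps k Eps q r => [//|i ps IH] k Eps q r eqX.
have [Ei Eps'] := drop_enum_ord_cons Eps.
have {}IH p t : holds (s := fix_system) (map (@event _ _ rho) ps) p t =
    holds (s := s) (map (@event _ _ (set_var rho z X)) ps) p t.
  apply: (IH i.+1 (esym Eps')) => j ij; apply: eqX; rewrite -Ei; exact: ltnW.
have eqi : (i \in X) = fix_now (tw_lab i)
    [set p | holds (s := s) (map (@event _ _ (set_var rho z X)) ps) p (tw_time i)].
  rewrite eqX ?Ei // inE /future -Eps'; congr (fix_now _ _).
  by apply/setP => p; rewrite !inE IH.
have eqS : [set p | holds (s := fix_system) (map (@event _ _ rho) ps) p (tw_time i)] =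
    [set p | holds (s := s) (map (@event _ _ (set_var rho z X)) ps) p (tw_time i)].
  by apply/setP => p; rewrite !inE IH.
have eqh c : head_holds (tw_time i - r)
      (fun p => holds (s := fix_system) (map (@event _ _ rho) ps) p r) c =
    head_holds (tw_time i - r)
      (fun p => holds (s := s) (map (@event _ _ (set_var rho z X)) ps) p r) c.
  by case: c => [p|I|I p] /=; rewrite ?IH.
rewrite [LHS]/= [RHS]/= has_cat !has_map eqS.
case: ifP => iX; move: eqi; rewrite iX => /esym eqi.
  rewrite [X in _ || X](eq_has (a2 := pred0)) ?has_pred0 ?orbF => [|c].
    by apply: eq_has => c /=; rewrite eqh eqi andbT.
  by rewrite /= eqi !andbF.
rewrite [X in X || _](eq_has (a2 := pred0)) ?has_pred0 /= => [|c].
  by apply: eq_has => c /=; rewrite eqh eqi andbT.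
by rewrite /= eqi !andbF.
Qed.

(** Membership of [i] itself in [X] is left open: guardedness lets the label [z] at [i] be erased,
    as [fix_now] does. *)
Lemma sat_fix_now (X : {set position rho}) (i : position rho) :
  (forall j : position rho, (i < j)%N -> (j \in X) = (j \in fix_set)) ->
  @sat R Sigma V phi (set_var rho z X) i <-> i \in fix_set.
Proof.
move=> eqX; have [satP gP] := rep; rewrite satP inE /fix_now.
have -> : started fix_system (future rho i.+1) (tw_time i) =
    started s (future (set_var rho z X) i.+1) (tw_time i).
  by apply/setP => p; rewrite !inE (@holds_fix_system X).
rewrite /=; case: ifP => _; last by [].
rewrite -(gP z gz _ (z |: _)).
have -> // : (z |: (tw_lab i).2) :\ z = (tw_lab i).2 :\ z.
by apply/setP => v; rewrite !inE; case: eqP.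
Qed.

Lemma fix_set_unique (X : {set position rho}) :
  fixpoint (fun Y k => @sat R Sigma V phi (set_var rho z Y) k) X <-> X = fix_set.
Proof.
split=> [fixX|->]; last by move=> i; apply: sat_fix_now.
(* Induction on the distance to the last position: the value at [i] is determined by those at later
   positions. *)
apply/setP => i; have [m] := ubnP (tw_last rho - i)%N.
elim: m i => // m IH i lem.
have later (j : position rho) : (i < j)%N -> (j \in X) = (j \in fix_set).
  move=> ij; apply: IH; have lej := ltn_ord j; rewrite ltnS in lej.
  by apply: leq_trans (ltn_sub2l (leq_trans ij lej) ij) _.
have /sat_fix_now satX := later; have fixXi := fixX i.
by apply/idP/idP => [/fixXi /satX|/satX /fixXi].
Qed.

End FixSystem.

(** A unique fixpoint is both least and greatest, so one system serves for both binders. *)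
Lemma representable_fix z phi : representable phi -> guarded_var z phi ->
  representable (FMu z phi) /\ representable (FNu z phi).
Proof.
case=> s [now [rep um]] gz; have uniqX rho := @fix_set_unique s z now phi rho rep gz.
have um' : rat_free phi -> unmixed (fix_system z now).
  by move=> /um {}um q a /=; rewrite all_cat !all_map; apply/andP; split;
    [have := um q (a.1, z |: a.2) | have := um q (a.1, a.2 :\ z)].
have g' y : z = y \/ guarded_var y phi -> forall a S,
    fix_now z now (a, S :\ y) =1 fix_now z now (a, S).
  move=> gy a S X; rewrite /fix_now /=.
  have -> : S :\ y :\ z = S :\ z :\ y by rewrite !setDDl setUC.
  (* The bound variable is erased by [fix_now] anyway; any other variable is guarded in the body. *)
  case: gy => [<-|gy]; first by rewrite setDDl setUid.
  by have [_ ->] := rep.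
split; exists (fix_system z now), (fix_now z now); split=> //; split=> [rho i|y gy] //.
all: try exact: g'.
all: split=> [[X [[/uniqX -> _]]]|iX]; rewrite ?inE //.
all: exists (fix_set z now rho); split; rewrite ?inE //; split; first exact/uniqX.
all: by move=> Y /uniqX ->.
Qed.

Lemma guarded_representable phi : guarded phi -> representable phi.
Proof.
elim: phi => [a||v|p IHp q IHq|p IHp|J n Fs IHF re|J n Fs IHF re p IHp
             |J n Fs IHF re p IHp|z p IHp|z p IHp] /=.
- by move=> _; apply: (@void_system_represents _ (fun l => a \in val l.1)).
- by move=> _; apply: (@void_system_represents _ xpredT).
- move=> _; apply: (@void_system_represents _ (fun l => v \in l.2)) => //= z vz a S.
  by rewrite !inE; case: eqP.
- by case=> /IHp rp /IHq rq; apply: representable_and.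
- by move=> /IHp; apply: representable_neg.
- by move=> gF; apply: representable_rat => a; apply: IHF.
- by case=> gF /IHp rp; apply: representable_frat => // a; apply: IHF.
- case=> gF /IHp rp.
  have rF a := IHF a (gF a).
  (* [GRat] unfolds to the negation of [FRat] applied to a negation. *)
  exact: (representable_neg (representable_frat J re rF (representable_neg rp))).
- by case=> gz /IHp rp; have [] := representable_fix rp gz.
- by case=> gz /IHp rp; have [] := representable_fix rp gz.
Qed.

End Representation.

(** * From systems to alternating automata *)

Section Compilation.
Variables (Sigma V : finType) (s : system (letter Sigma * {set V})).
Variable now : letter Sigma * {set V} -> pred {set loc s}.
Local Notation Q := (loc s).

(* [Some (q, true)] holds when [q] does, and [Some (q, false)] when it does not. *)
Definition dual_loc : finType := option (Q * bool).

(** Each disjunct prescribes the exact set [X] of started locations that hold. The doubling makes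
    this a positive combination of resets even if [b] is not monotone. *)
Definition reset_dnf (b : pred {set Q}) : ata_form dual_loc :=
  big_or [seq big_and [seq AReset (Some (q, q \in (X : {set Q})) : dual_loc) | q <- enum Q] |
    X <- enum {: {set Q}} & b X].

Definition pos_head (h : clause_head Q) : ata_form dual_loc :=
  match h with
  | HLoc q => ALoc (Some (q, true) : dual_loc)
  | HClock J => AClock J
  | HBoth J q => AAnd (AClock J) (ALoc (Some (q, true) : dual_loc))
  end.

Definition neg_head (h : clause_head Q) : ata_form dual_loc :=
  match h with
  | HLoc q => ALoc (Some (q, false) : dual_loc)
  | HClock J => AClock_out dual_loc J
  | HBoth J q => AOr (AClock_out dual_loc J) (ALoc (Some (q, false) : dual_loc))
  end.

Definition compiled_delta (q : dual_loc) (a : letter Sigma) : ata_form dual_loc :=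
  match q with
  | None => big_or [:: reset_dnf (now (a, set0))]
  | Some (q, true) =>
      big_or [seq AAnd (pos_head c.1) (reset_dnf c.2) | c <- loc_delta q (a, set0)]
  | Some (q, false) =>
      big_and [seq AOr (neg_head c.1) (reset_dnf (predC c.2)) |
        c <- loc_delta q (a, set0)]
  end.

(** [None] only evaluates [now] at the first letter. It need not be final, as timed words are
    nonempty and no transition formula mentions it. *)
Definition compiled_ata : ata (letter Sigma) :=
  @Ata _ dual_loc None
    [set q | if q is Some (q, b) then loc_final q == b else false] compiled_delta.

Lemma reset_comb_big_or (P : finType) (fs : seq (ata_form P)) :
  all (@reset_comb P) fs -> reset_comb (big_or fs).
Proof. by elim: fs => //= f fs IH /andP [-> /IH]. Qed.

Lemma reset_comb_big_and (P : finType) (fs : seq (ata_form P)) :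
  all (@reset_comb P) fs -> reset_comb (big_and fs).
Proof. by elim: fs => //= f fs IH /andP [-> /IH]. Qed.

Lemma reset_comb_dnf b : reset_comb (reset_dnf b).
Proof.
apply: reset_comb_big_or; rewrite all_map; apply/allP => X _ /=.
by apply: reset_comb_big_and; rewrite all_map; apply/allP.
Qed.

(** The negative copies are the conjunctive locations: De Morgan turns each unmixed clause into a
    disjunctive one. [None] is disjunctive, with a single clause made of resets. *)
Lemma compiled_ata_conj_disj : unmixed s -> conj_disj_ata compiled_ata.
Proof.
move=> um; exists [set q : dual_loc | if q is Some (_, false) then true else false].
case=> [[q []]|] a; rewrite inE /=.
- eexists; split; first by [].
  elim: (loc_delta q _) (um q (a, set0)) => [|c cs IH] /=; first by constructor.
  case/andP=> cb /IH {}IH; constructor=> //; case: c cb => -[p|J|J p] b //= _.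
    by constructor; rewrite ?inE ?reset_comb_dnf.
  by constructor; rewrite reset_comb_dnf.
- eexists; split; first by [].
  elim: (loc_delta q _) (um q (a, set0)) => [|c cs IH] /=; first by constructor.
  case/andP=> cb /IH {}IH; constructor=> //; case: c cb => -[p|J|J p] b //= _.
    by constructor; rewrite ?inE ?reset_comb_dnf.
  by apply: DClockOut; rewrite reset_comb_dnf.
- exists [:: reset_dnf (now (a, set0))]; split=> //.
  by constructor; [apply: CReset; apply: reset_comb_dnf | constructor].
Qed.

(** * Correctness of the compiled automaton *)

Section Semantics.
Variable R : realType.

Lemma ata_sat_big_or (P : finType) (nu : R) (M : {set P + P}) fs :
  ata_sat nu M (big_or fs) = has (ata_sat nu M) fs.
Proof. by elim: fs => //= f fs ->. Qed.

Lemma ata_sat_big_and (P : finType) (nu : R) (M : {set P + P}) fs :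
  ata_sat nu M (big_and fs) = all (ata_sat nu M) fs.
Proof. by elim: fs => //= f fs ->. Qed.

Lemma ata_sat_out (P : finType) (nu : R) (M : {set P + P}) J :
  ata_sat nu M (AClock_out P J) = ~~ in_nat_itv nu J.
Proof. by case: J => l u; rewrite -in_nat_itv_out. Qed.

(** By the hypothesis on [M], only the disjunct for [X] itself can be satisfied. *)
Lemma ata_sat_dnf (nu : R) (M : {set dual_loc + dual_loc}) (X : {set Q}) b :
  (forall q c, (inr (Some (q, c)) \in M) = ((q \in X) == c)) ->
  ata_sat nu M (reset_dnf b) = b X.
Proof.
move=> MX; rewrite ata_sat_big_or has_map.
have satY (Y : {set Q}) : ata_sat nu M
    (big_and [seq AReset (Some (q, q \in Y) : dual_loc) | q <- enum Q]) = (Y == X).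
  rewrite ata_sat_big_and all_map; apply/allP/eqP => [allY|-> q _ /=].
    by apply/setP => q; have := allY q; rewrite mem_enum /= MX => /(_ isT) /eqP ->.
  by rewrite MX eqxx.
by rewrite (eq_has (a2 := pred1 X) satY) has_pred1 mem_filter mem_enum andbT.
Qed.

Let lift (w : seq (R * letter Sigma)) : seq (R * (letter Sigma * {set V})) :=
  [seq (x.1, (x.2, set0)) | x <- w].

(** Both copies are treated together, since [reset_dnf] refers to the two of them in either case. *)
Lemma compiled_win (w : seq (R * letter Sigma)) (q : Q) (b : bool) (r : R) :
  ata_win (A := compiled_ata) w (Some (q, b)) r = (holds (lift w) q r == b).
Proof.
elim: w q b r => [|[t a] w IH] q b r /=; first by rewrite inE.
set M := ata_targets _ _.
have satb c : ata_sat (t - r) M (reset_dnf c) = c [set p | holds (lift w) p t].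
  by apply: ata_sat_dnf => p d; rewrite !inE IH.
have pos h : ata_sat (t - r) M (pos_head h) =
    head_holds (t - r) (fun p => holds (lift w) p r) h.
  by case: h => [p|J|J p] //=; rewrite inE IH eqb_id.
have neg h : ata_sat (t - r) M (neg_head h) =
    ~~ head_holds (t - r) (fun p => holds (lift w) p r) h.
  by case: h => [p|J|J p] //=; rewrite ?ata_sat_out ?negb_and // inE IH eqbF_neg.
case: b => /=.
  rewrite eqb_id ata_sat_big_or has_map; apply: eq_has => c /=.
  by rewrite pos satb.
rewrite eqbF_neg ata_sat_big_and all_map -all_predC; apply: eq_all => c /=.
by rewrite neg satb negb_and.
Qed.

Lemma compiled_ata_accepts (rho : timed_word R (letter Sigma)) :
  accepts compiled_ata rho <->
  now (tw_lab (ord0 : position rho), set0)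
    (started s (lift (future rho 1)) (tw_time (ord0 : position rho))).
Proof.
rewrite acceptsP -[enum _]drop0 (drop_enum_ord (ord0 : position rho)) /=.
set M := ata_targets _ _; rewrite orbF.
rewrite (@ata_sat_dnf _ M
  (started s (lift (future rho 1)) (tw_time (ord0 : position rho)))) //.
by move=> q c; rewrite !inE compiled_win.
Qed.

End Semantics.
End Compilation.

Lemma guarded_compiled (R : realType) (Sigma V : finType) (psi : formula Sigma V) :
  guarded psi ->
  exists A : ata (letter Sigma), (rat_free psi -> conj_disj_ata A) /\
    forall rho : timed_word R (letter Sigma), models rho psi <-> accepts A rho.
Proof.
case/(@guarded_representable R) => s [now [[satP _] um]].
exists (compiled_ata now); split=> [/um|rho]; first exact: compiled_ata_conj_disj.
rewrite compiled_ata_accepts /models satP /=.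
(* The empty labels put in by [models] are those that the compiled automaton assumes. *)
by rewrite /future -map_comp.
Qed.

Theorem theorem7 (R : realType) (Sigma : finType) :
  (forall (V : finType) (psi : formula Sigma V),
     sentence psi -> guarded psi ->
     exists A : ata (letter Sigma),
       forall rho : timed_word R (letter Sigma),
         models rho psi <-> accepts A rho)
  /\
  (forall (V : finType) (psi : formula Sigma V),
     sentence psi -> guarded psi -> rat_free psi ->
     exists A : ata (letter Sigma),
       conj_disj_ata A /\
       forall rho : timed_word R (letter Sigma),
         models rho psi <-> accepts A rho).
Proof.
split=> V psi _ /(@guarded_compiled R) [A [cd acc]]; first by exists A.
by move=> /cd cdA; exists A.
Qed.
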